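(* Let $G$ be a connected graph of order $n\geq 4$. Then \[ 3\leq \gamma_t(C(G))\leq n+\lceil n/2\rceil -1 . \]
   Context: For a graph $G=(V,E)$ with $V=\{v_1,\dots,v_n\}$, the central graph $C(G)$ is the graph with vertex set $V\cup\{c_{ij} : v_iv_j\in E\}$ obtained by subdividing each edge $v_iv_j$ of $G$ exactly once by a new vertex $c_{ij}$ (adjacent to exactly $v_i$ and $v_j$) and joining every pair of distinct vertices non-adjacent in $G$. A total dominating set of a graph $H$ is a set $S\subseteq V(H)$ such that every vertex of $H$ has a neighbor in $S$; $\gamma_t(H)$ is the minimum cardinality of a total dominating set of $H$. *)

(* Defs.v *)
From HB Require Import structures.
From mathcomp Require Import all_boot.
Set Implicit Arguments. Unset Strict Implicit. Unset Printing Implicit Defensive.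

Record sgraph := SGraph {
  vertex :> finType;
  adj : rel vertex;
  adj_sym : symmetric adj;
  adj_irr : irreflexive adj }.

Definition connected (G : sgraph) := forall x y : G, connect (@adj G) x y.

Definition edge_set (G : sgraph) : {set {set G}} :=
  [set [set p.1; p.2] | p : G * G & adj p.1 p.2].

Definition edge (G : sgraph) := {A : {set G} | A \in edge_set G}.

Section CentralGraph.
Variable G : sgraph.

(* [inl v] is the original vertex v; [inr c] is the vertex subdividing the
   edge c = {v_i, v_j}. *)
Definition central_adj : rel (G + edge G) := fun a b =>
  match a, b with
  | inl x, inl y => (x != y) && ~~ adj x y
  | inl x, inr c | inr c, inl x => x \in val c
  | inr _, inr _ => false
  end.

Lemma central_adj_sym : symmetric central_adj.
Proof. by move=> [x|c] [y|d] //=; rewrite eq_sym adj_sym. Qed.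

Lemma central_adj_irr : irreflexive central_adj.
Proof. by move=> [x|c] //=; rewrite eqxx. Qed.

Definition central_graph : sgraph := SGraph central_adj_sym central_adj_irr.

End CentralGraph.

Definition total_dominating (H : sgraph) (S : {set H}) : bool :=
  [forall x : H, exists y in S, adj x y].

(* Meaningful when H has a total dominating set, equivalently when [setT] is
   one; [gamma_tP] and [central_graph_total_dominating] below show that this
   is so for central graphs of graphs with at least two vertices. *)
Definition gamma_t (H : sgraph) : nat :=
  #|[arg min_(S < [set: H] | total_dominating S) #|S|]|.

Lemma total_dominatingS (H : sgraph) (S S' : {set H}) :
  S \subset S' -> total_dominating S -> total_dominating S'.
Proof.
move=> sSS' /forallP tdS; apply/forallP => x.
have /exists_inP[y yS xy] := tdS x.
by apply/exists_inP; exists y => //; apply: (subsetP sSS').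
Qed.

Lemma gamma_tP (H : sgraph) (S0 : {set H}) : total_dominating S0 ->
  (exists2 S : {set H}, total_dominating S & #|S| = gamma_t H) /\
  (forall S : {set H}, total_dominating S -> gamma_t H <= #|S|).
Proof.
move=> /(total_dominatingS (subsetT S0)) tdT; rewrite /gamma_t.
by case: arg_minnP => // S tdS minS; split; [exists S | apply: minS].
Qed.

Lemma central_graph_total_dominating (G : sgraph) :
  1 < #|G| -> total_dominating [set: central_graph G].
Proof.
move=> G_gt1; apply/forallP => -[x|c]; apply/exists_inP; last first.
  case: c => A EA; have /imsetP[[x y] /= _ defA] := EA.
  by exists (inl x); rewrite ?inE //= defA !inE eqxx.
have /card_gt0P[y] : 0 < #|[set~ x]| by rewrite cardsC1 -subn1 subn_gt0.
rewrite !inE => neq_yx.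
have [xy|nxy] := boolP (adj x y); last first.
  by exists (inl y); rewrite ?inE //= eq_sym neq_yx.
have Exy : [set x; y] \in edge_set G by apply/imsetP; exists (x, y); rewrite ?inE.
by exists (inr (Sub [set x; y] Exy : edge G)); rewrite ?inE //= !inE eqxx.
Qed.

(* Main.v *)
(** Lower bound: a total dominating set of size two is a pair of adjacent
    vertices of [C(G)].  If it is [{x, y}] with [x], [y] non-adjacent in [G],
    then every edge of [G] meets [{x, y}] and no vertex is adjacent to both, so
    [x] together with its neighbours is a union of components avoiding [y].  If
    it is [{x, c}] with [c] subdividing the edge [xy], then [{x, y}] is a
    component.  Both contradict connectedness.

    Upper bound: fix a vertex [v] and start from [V \ {v}], which dominates all
    subdivision vertices.  The vertices [x] left undominated are those adjacent
    in [G] to all of [V \ {v, x}]; they form a clique, so pairing them up shows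
    that [uphalf n] subdivision vertices suffice to dominate them. *)
Require Import Defs.
From HB Require Import structures.
From mathcomp Require Import all_boot.

Set Implicit Arguments. Unset Strict Implicit. Unset Printing Implicit Defensive.

Lemma connected_invariant (G : sgraph) (A : {set G}) (x y : G) :
  connected G -> (forall u w, adj u w -> u \in A -> w \in A) ->
  x \in A -> y \in A.
Proof.
move=> Gconn invA; rewrite (_ : (x \in A) = (y \in A)) //.
apply: closed_connect (Gconn x y); apply: intro_closed => //.
exact: sym_connect_sym (@adj_sym G).
Qed.

Lemma connected_has_neighbor (G : sgraph) (x : G) :
  connected G -> 1 < #|G| -> exists y, adj x y.
Proof.
move=> Gconn; rewrite (cardD1 x) ltnS => /card_gt0P[y /andP[/= neq_yx _]].
have [/existsP //|/existsPn noadj] := boolP [exists y, adj x y].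
(* If [x] is isolated, its singleton is closed under adjacency, so connectedness puts [y] in it. *)
have : y \in [set x].
  apply: connected_invariant Gconn _ (set11 x) => u w uw /set1P ux.
  by case/negP: (noadj w); rewrite -ux.
by rewrite inE (negPf neq_yx).
Qed.

Lemma adj_edge_set (G : sgraph) (x y : G) :
  adj x y -> [set x; y] \in edge_set G.
Proof. by move=> xy; apply/imsetP; exists (x, y); rewrite ?inE. Qed.

Definition edge_of (G : sgraph) (x y : G) (xy : adj x y) : edge G :=
  exist _ [set x; y] (adj_edge_set xy).

Lemma edgeP (G : sgraph) (c : edge G) :
  exists x y, adj x y /\ val c = [set x; y].
Proof.
by case: c => A /= /imsetP[[x y]]; rewrite inE /= => xy ->; exists x, y.
Qed.

(** Induction removing two vertices of [D] at a time: the edge joining them covers both. A last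
    single vertex is covered by an edge to any neighbour, possibly outside [D]; this accounts for
    the rounding up. *)
Lemma clique_edge_cover (G : sgraph) (D : {set G}) :
  {in D &, forall x y, x != y -> adj x y} ->
  {in D, forall x, exists y, adj x y} ->
  exists2 F : {set edge G}, #|F| <= uphalf #|D| &
    {in D, forall x, exists2 c, c \in F & x \in val c}.
Proof.
have [m] := ubnP #|D|; elim: m D => // m IHm D; rewrite ltnS => leDm cliqueD nbD.
have [->|[x xD]] := set_0Vmem D.
  by exists set0; rewrite ?cards0 // => x; rewrite inE.
have [D1|[y]] := set_0Vmem (D :\ x).
  have [y xy] := nbD x xD.
  exists [set edge_of xy]; first by rewrite cards1 (cardsD1 x) xD.
  move=> z zD; exists (edge_of xy); rewrite ?inE //=.
  by move/setP/(_ z): D1; rewrite !inE zD andbT => /negbFE->.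
move=> yD1; have /setD1P[neq_yx yD] := yD1.
have xy : adj x y by rewrite cliqueD // eq_sym.
have cardD : #|D| = #|D :\ x :\ y|.+2.
  by rewrite (cardsD1 x D) xD (cardsD1 y (D :\ x)) yD1.
have subD z : z \in D :\ x :\ y -> z \in D by rewrite !inE => /and3P[].
have [|z w /subD zD /subD wD|z /subD /nbD //|F leF covF] := IHm (D :\ x :\ y).
- by rewrite cardD in leDm; apply: leq_trans leDm.
- exact: cliqueD.
exists (edge_of xy |: F).
  by rewrite cardsU1 cardD; case: (_ \notin _) => //; apply: leqW.
move=> z zD; have [zxy|] := boolP (z \in [set x; y]).
  by exists (edge_of xy); rewrite ?setU11.
rewrite !inE negb_or => /andP[neq_zx neq_zy].
have [|c cF zc] := covF z; first by rewrite !inE neq_zx neq_zy.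
by exists c; rewrite ?setU1r.
Qed.

Lemma total_dominating_nonadjacent_pair (G : sgraph) (x y : G) :
  connected G -> x != y -> ~~ adj x y ->
  ~~ @total_dominating (central_graph G) [set inl x; inl y].
Proof.
move=> Gconn neq_xy nxy; apply/negP => /forallP td.
(* Among original vertices, domination in the central graph means non-adjacency in [G]. *)
have noboth z : adj x z -> adj y z -> False.
  have /exists_inP[b] := td (inl z).
  by rewrite !inE => /orP[]/eqP-> /= /andP[_]; rewrite adj_sym => /negPf->.
have meet u w : adj u w -> [|| u == x, u == y, w == x | w == y].
  move=> uw; have /exists_inP[b] := td (inr (edge_of uw)).
  by rewrite !inE => /orP[]/eqP-> /=; rewrite !inE ![_ == u]eq_sym ![_ == w]eq_sym;
    case/orP=> ->; rewrite ?orbT.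
have : y \in x |: [set z | adj x z].
  apply: (@connected_invariant G _ x) => //; last by rewrite setU11.
  move=> u w uw; rewrite !inE => /orP[/eqP<-|xu]; first by rewrite uw orbT.
  case/or4P: (meet u w uw) => /eqP eq; subst => //.
  - by rewrite uw orbT.
  - by rewrite xu in nxy.
  - by rewrite eqxx.
  - by case: (noboth u); rewrite // adj_sym.
by rewrite !inE eq_sym (negPf neq_xy) (negPf nxy).
Qed.

Lemma total_dominating_vertex_edge (G : sgraph) (x : G) (c : edge G) :
  connected G -> 2 < #|G| -> x \in val c ->
  ~~ @total_dominating (central_graph G) [set inl x; inr c].
Proof.
move=> Gconn G_gt2 xc; apply/negP => /forallP td.
have invc u w : adj u w -> u \in val c -> w \in val c.
  move=> uw uc; have [->//|neq_wx] := eqVneq w x.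
  (* Only [inl x] can dominate this subdivision vertex, so [u = x]. Then [w] is a neighbour of [x]
     in [G], so [inl w] must be dominated by [inr c]. *)
  have /exists_inP[b] := td (inr (edge_of uw)).
  rewrite !inE => /orP[]/eqP-> //=; rewrite !inE [x == w]eq_sym (negPf neq_wx) orbF.
  move=> /eqP ux; have /exists_inP[b'] := td (inl w).
  by rewrite !inE => /orP[]/eqP-> //= /andP[_]; rewrite adj_sym ux uw.
have : #|G| <= #|val c|.
  rewrite -cardsT subset_leq_card //; apply/subsetP => z _.
  exact: connected_invariant Gconn invc xc.
have [u [w [_ ->]]] := edgeP c; rewrite cards2 leqNgt.
by rewrite (leq_trans _ G_gt2) //; case: (_ == _).
Qed.

Lemma central_total_dominating_gt2 (G : sgraph) (S : {set central_graph G}) :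
  connected G -> 2 < #|G| -> total_dominating S -> 2 < #|S|.
Proof.
move=> Gconn G_gt2 tdS; rewrite ltnNge; apply/negP => leS2.
have /card_gt0P[v _] : 0 < #|G| by apply: leq_trans G_gt2.
have /forallP td := tdS.
have /exists_inP[a aS _] := td (inl v).
have /exists_inP[b bS ab] := td a.
have neq_ab : a != b.
  by apply: contraTneq ab => ->; rewrite adj_irr.
have defS : S = [set a; b].
  apply/eqP; rewrite eq_sym eqEcard subUset !sub1set aS bS /=.
  by rewrite cards2 neq_ab.
move: tdS; rewrite {}defS {td aS bS}.
(* Two subdivision vertices are never adjacent, so three cases remain. *)
case: a b ab neq_ab => [x|c] [y|d] //= ab _; apply/negP.
- by case/andP: ab; apply: total_dominating_nonadjacent_pair.
- exact: total_dominating_vertex_edge.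
- by rewrite setUC; apply: total_dominating_vertex_edge.
Qed.

Lemma central_total_dominating_exists (G : sgraph) :
  connected G -> 1 < #|G| ->
  exists2 S : {set central_graph G},
    total_dominating S & #|S| <= #|G|.-1 + uphalf #|G|.
Proof.
move=> Gconn G_gt1.
have /card_gt0P[v _] : 0 < #|G| by apply: leq_trans G_gt1.
(* The original vertices, possibly including [v], that no [inl y] with [y != v] dominates. *)
pose D := [set x : G | [forall y, (y != v) && (y != x) ==> adj x y]].
have cliqueD : {in D &, forall x y, x != y -> adj x y}.
  move=> x y; rewrite !inE => /forallP Dx /forallP Dy neq_xy.
  (* Membership of [x] in [D] says nothing about adjacency to [v]; when [y = v], membership of [y]
     supplies it. *)
  have [yv|neq_yv] := eqVneq y v.
    by rewrite adj_sym; apply: (implyP (Dy x)); rewrite -yv neq_xy.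
  by apply: (implyP (Dx y)); rewrite neq_yv eq_sym.
have [|F leF covF] := clique_edge_cover cliqueD.
  by move=> x _; apply: connected_has_neighbor.
pose S : {set central_graph G} := [set inl x | x in [set~ v]] :|: [set inr c | c in F].
have vS x : x != v -> inl x \in S.
  by move=> neq_xv; rewrite inE imset_f // !inE.
exists S; last first.
  apply: leq_trans (leq_card_setU _ _) _; rewrite -(cardsC1 v).
  apply: leq_add; first exact: leq_imset_card.
  apply: leq_trans (leq_imset_card _ _) (leq_trans leF _).
  by apply: uphalf_leq; apply: max_card.
apply/forallP => -[x|c]; apply/exists_inP.
  have [/covF[c cF xc]|] := boolP (x \in D).
    by exists (inr c); rewrite // inE orbC imset_f.
  rewrite inE => /forallPn[y]; rewrite negb_imply => /andP[/andP[yv yx] nxy].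
  by exists (inl y); rewrite ?vS //= eq_sym yx.
have [x [y [xy defc]]] := edgeP c.
(* The ends of an edge are distinct, so at least one differs from [v]. *)
have [xv|neq_xv] := eqVneq x v; last first.
  by exists (inl x); rewrite ?vS //= defc set21.
exists (inl y); last by rewrite /= defc set22.
by apply: vS; apply: contraTneq xy => ->; rewrite xv adj_irr.
Qed.

Theorem theorem2p6 (G : sgraph) (n : nat) (Gconn : connected G)
    (Gorder : #|G| = n) (n_ge4 : 4 <= n) :
  3 <= gamma_t (central_graph G) <= n + uphalf n - 1.
Proof.
have G_gt2 : 2 < #|G| by rewrite Gorder (leq_trans _ n_ge4).
have [S tdS leS] := central_total_dominating_exists Gconn (ltnW G_gt2).
have [[S0 tdS0 cardS0] /(_ S tdS) minS] := gamma_tP tdS.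
rewrite -{1}cardS0 central_total_dominating_gt2 //= (leq_trans minS) //.
by rewrite Gorder in leS; rewrite addnC -addnBA 1?addnC ?subn1 // (leq_trans _ n_ge4).
Qed.
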